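(* Let $k$ be a positive integer, let $f(x)=\sum_{i=0}^{k-1}a_ix^i\in\mathbb{Z}[x]$, and let $N$ denote the absolute norm of $\mathbb{Q}(\zeta_k)$. Then $$|N(f(\zeta_k))|\le\left(\frac{k}{\varphi(k)}\sum_{i=0}^{k-1}a_i^2\right)^{\varphi(k)/2}.$$ In particular, if $\sum_{i=0}^{k-1}a_i^2\ge 3$, then $$|N(f(\zeta_k))|\le\left(\sum_{i=0}^{k-1}a_i^2\right)^{k/2}.$$
   Context: $\zeta_k$ is a complex primitive $k$th root of unity, $\varphi$ is Euler's totient function, and the absolute norm of $\mathbb{Q}(\zeta_k)$ is the field norm from $\mathbb{Q}(\zeta_k)$ to $\mathbb{Q}$, so $N(f(\zeta_k))=\prod_{1\le j\le k,\ \gcd(j,k)=1}f(\zeta_k^j)$. *)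

(* Defs.v *)
From mathcomp Require Export all_boot all_order all_algebra all_field.
From mathcomp Require Export complex.
From mathcomp Require Export reals exp.

Import GRing.Theory Num.Theory.
Local Open Scope ring_scope.

(* The field norm from Q(z) = <<1; z>> to Q.  The ambient field L is any number
   field, normal over Q, containing z.  galNorm multiplies the conjugates of x
   under 'Gal(Q(z) / Q); this is the field norm because Q(z) is Galois over Q
   when z is a root of unity.  The value is a rational number, seen in L. *)
Definition cyclotomic_norm (L : splittingFieldType rat) (z x : L) : L :=
  galNorm 1%AS <<1; z>>%AS x.

(* Main.v *)
Require Import Defs.
From mathcomp Require Import sequences lra.
Import Order.TTheory GRing.Theory Num.Theory ComplexField.
Local Open Scope ring_scope.
Local Open Scope complex_scope.

(** The absolute value of the norm of f(z) is the product of the |f(w)| over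
    the conjugates w of z.  There are exactly phi(k) of them, because the
    cyclotomic polynomial is irreducible over Q ([card_gal_prim_root]), and
    they are distinct powers of the primitive root.

    Squaring and applying the inequality between arithmetic and geometric
    means bounds the squared norm by the phi(k)-th power of 1/phi(k) times the
    sum of |f(w)|^2 over the conjugates.  Enlarging this sum to all k-th roots
    of unity only increases it, and the larger sum equals k times the sum of
    the a_i^2 by Parseval's identity ([Parseval_prim_root]).  This gives
    |N|^2 <= (k/phi(k) * S)^phi(k) ([norm_cyclotomic_norm_le]), whose square
    root is the first bound.

    For the second bound, put t = k/phi(k), so t <= e^(t-1), and hence
    t^phi(k) <= e^(k-phi(k)) <= S^(k-phi(k)) as soon as S >= 3 >= e
    ([expn_ratio_le]).  Multiplying by S^phi(k) turns the previous bound on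
    |N|^2 into S^k. *)

(** * The degree of a cyclotomic extension *)

(** Evaluating the factorization of X^n - 1 into cyclotomic polynomials at z
    shows that z is a root of some Phi_d with d dividing n; then z^d = 1, and
    primitivity forces d = n. *)
Lemma root_Cyclotomic (F : fieldType) (n : nat) (z : F) :
  n.-primitive_root z -> root (map_poly intr 'Phi_n) z.
Proof.
move=> prim_z; have n_gt0 := prim_order_gt0 prim_z.
have prodE d : (0 < d)%N ->
    \prod_(e <- divisors d) (map_poly intr 'Phi_e).[z] = z ^+ d - 1.
  move=> d_gt0; rewrite -horner_prod -rmorph_prod prod_Cyclotomic //.
  by rewrite rmorphB /= rmorph1 map_polyXn hornerD hornerN hornerXn hornerC.
have /eqP := prodE n n_gt0; rewrite (prim_expr_order prim_z) subrr.
rewrite prodf_seq_eq0 => /hasP[d]; rewrite -dvdn_divisors // => d_dv_n /= Pd0.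
have d_gt0 := dvdn_gt0 n_gt0 d_dv_n.
suff -> : n = d by [].
apply/eqP; rewrite eqn_dvd d_dv_n andbT (prim_order_dvd prim_z).
rewrite -subr_eq0 -prodE // prodf_seq_eq0; apply/hasP; exists d => //.
by rewrite -dvdn_divisors.
Qed.

(** A factor of Phi_n either has a given algebraic primitive root w as a root
    or its cofactor does.  The minimal polynomial of w over Q already has
    degree phi(n), so whichever of the two vanishes at w has full degree. *)
Lemma Cyclotomic_irreducible (n : nat) :
  (0 < n)%N -> irreducible_poly (map_poly intr 'Phi_n : {poly rat}).
Proof.
move=> n_gt0; have [w prim_w] := C_prim_root_exists n_gt0.
have sz_Phi : size (map_poly intr 'Phi_n : {poly rat}) = (totient n).+1.
  by rewrite size_map_inj_poly ?size_Cyclotomic //; apply: intr_inj.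
have [P [DP mon_P] dvP] := minCpolyP w.
have sz_P : size P = (totient n).+1.
  by rewrite -(size_map_poly (ratr : rat -> algC)) -DP
             (minCpoly_cyclotomic prim_w) size_cyclotomic.
split=> [|q q_n1 q_dv]; first by rewrite sz_Phi ltnS totient_gt0.
have Phi_neq0 : (map_poly intr 'Phi_n : {poly rat}) != 0.
  by rewrite -size_poly_gt0 sz_Phi.
have /dvdpP[g Dg] := q_dv.
have [g0 q0] : g != 0 /\ q != 0.
  by apply/andP; move: Phi_neq0; rewrite Dg mulf_eq0 negb_or.
have szM : (size g + size q = (totient n).+2)%N.
  by move: sz_Phi; rewrite Dg size_mul // => <-; rewrite prednK // addn_gt0
     size_poly_gt0 g0.
have : root (map_poly ratr (map_poly intr 'Phi_n : {poly rat})) w.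
  have := root_Cyclotomic _ _ _ prim_w; rewrite -map_poly_comp.
  congr (root _ w); apply: eq_map_poly => c; by rewrite /= rmorph_int.
rewrite Dg rmorphM rootM !dvP => /orP[] /dvdp_leq.
  rewrite sz_P => /(_ g0) le_g; case/negP: q_n1.
  by rewrite eqn_leq size_poly_gt0 q0 andbT -(leq_add2l (size g)) szM addn1.
move=> /(_ q0); rewrite sz_P => le_q; rewrite -dvdp_size_eqp -?Dg //.
rewrite sz_Phi eqn_leq le_q andbT.
by rewrite -sz_Phi dvdp_leq.
Qed.

(** The minimal polynomial of z divides the irreducible polynomial Phi_n, hence
    has the same degree. *)
Lemma adjoin_degree_prim_root (L : fieldExtType rat) (n : nat) (z : L) :
  n.-primitive_root z -> adjoin_degree 1%AS z = totient n.
Proof.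
move=> prim_z; have n_gt0 := prim_order_gt0 prim_z.
have [p Dp] := polyOver1P (minPolyOver 1%AS z).
have sz_p : size p = (adjoin_degree 1%AS z).+1.
  by rewrite -size_minPoly Dp size_map_poly.
have [_ irr] := Cyclotomic_irreducible n n_gt0.
have DPhi : map_poly (GRing.in_alg L) (map_poly intr 'Phi_n) =
            map_poly intr 'Phi_n.
  rewrite -map_poly_comp; apply: eq_map_poly => c.
  exact: (rmorph_int (GRing.in_alg L)).
have p_dv : p %| map_poly intr 'Phi_n.
  rewrite -(dvdp_map (GRing.in_alg L)) -Dp DPhi minPoly_dvdp //.
    by rewrite -DPhi; apply/polyOver1P; exists (map_poly intr 'Phi_n).
  exact: root_Cyclotomic.
apply: succn_inj; rewrite -sz_p -size_Cyclotomic.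
rewrite -(@size_map_inj_poly _ rat intr) //; last exact: intr_inj.
by apply: eqp_size; apply: irr; rewrite // sz_p.
Qed.

(** The field Q(z) is the splitting field of the separable polynomial X^n - 1,
    whose roots are the powers of z. *)
Lemma galois_prim_root (L : splittingFieldType rat) (n : nat) (z : L) :
  n.-primitive_root z -> galois 1%AS <<1; z>>%AS.
Proof.
move=> prim_z; have n_gt0 := prim_order_gt0 prim_z.
apply/splitting_galoisField; exists ('X^n - 1); split.
- by rewrite rpredB ?rpred1 ?rpredX ?polyOverX.
- apply: separable_Xn_sub_1; rewrite -(rmorph_nat (GRing.in_alg L)).
  by rewrite fmorph_eq0 pnatr_eq0 -lt0n.
exists [seq z ^+ i | i <- iota 0 n].
  by rewrite big_map -(factor_Xn_sub_1 prim_z) /index_iota subn0 eqpxx.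
apply/eqP; rewrite eqEsubv; apply/andP; split.
  apply/Fadjoin_seqP; split; first exact: subv_adjoin.
  by move=> _ /mapP[i _ ->]; rewrite rpredX // memv_adjoin.
apply/FadjoinP; split; first exact: subv_adjoin_seq.
(* The list starts at exponent 0, so z itself is found as a power below n; for
   n = 1 this is z = z^0. *)
have [x Dx] := prim_rootP prim_z (prim_expr_order prim_z).
apply: seqv_sub_adjoin; apply/mapP; exists (x : nat) => //.
by rewrite mem_iota ltn_ord.
Qed.

Lemma card_gal_prim_root (L : splittingFieldType rat) (n : nat) (z : L) :
  n.-primitive_root z -> #|'Gal(<<1; z>> / 1)%g| = totient n.
Proof.
move=> prim_z; rewrite -galois_dim; last exact: galois_prim_root prim_z.
rewrite dimv1 divn1 dim_Fadjoin dimv1 muln1.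
exact: adjoin_degree_prim_root prim_z.
Qed.

(** * Parseval's identity on the roots of unity *)

(** Orthogonality of the characters of Z/n: off the diagonal the terms form a
    geometric progression of ratio w = z^i / z^j, with w <> 1 and w^n = 1. *)
Lemma sum_prim_root_ortho (F : fieldType) (n : nat) (z : F) (i j : 'I_n) :
  n.-primitive_root z ->
  \sum_(m < n) (z ^+ m) ^+ i / (z ^+ m) ^+ j = if i == j then n%:R else 0.
Proof.
move=> prim_z; have n_gt0 := prim_order_gt0 prim_z.
have z_neq0 : z != 0.
  apply/eqP=> z0; have /eqP := prim_expr_order prim_z.
  by rewrite z0 expr0n gtn_eqF // eq_sym oner_eq0.
have [->|neq_ij] := eqVneq i j.
  under eq_bigr do rewrite divff ?expf_neq0 //.
  by rewrite sumr_const card_ord.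
set w := z ^+ i / z ^+ j.
have w_neq1 : w - 1 != 0.
  rewrite subr_eq0; apply: contra neq_ij => /eqP w1.
  have : z ^+ i = z ^+ j.
    by rewrite -[LHS](divfK (expf_neq0 j z_neq0)) -/w w1 mul1r.
  by move/eqP; rewrite (eq_prim_root_expr prim_z) !modn_small.
apply: (mulfI w_neq1); rewrite mulr0.
have -> : \sum_(m < n) (z ^+ m) ^+ i / (z ^+ m) ^+ j = \sum_(m < n) w ^+ m.
  by apply: eq_bigr => m _; rewrite /w expr_div_n -!exprM !(mulnC m).
rewrite -subrX1 /w expr_div_n -!exprM ![(_ * n)%N]mulnC !exprM.
by rewrite (prim_expr_order prim_z) !expr1n divr1 subrr.
Qed.

(** Since conjugation inverts roots of unity, expanding |p(z^m)|^2 and summing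
    over m leaves the diagonal terms only, by orthogonality. *)
Lemma Parseval_prim_root (C : numClosedFieldType) (n : nat) (z : C)
    (p : {poly C}) :
  n.-primitive_root z -> (size p <= n)%N ->
  \sum_(m < n) `|p.[z ^+ m]| ^+ 2 = n%:R * \sum_(i < n) `|p`_i| ^+ 2.
Proof.
move=> prim_z le_pn; have n_gt0 := prim_order_gt0 prim_z.
have conj_z m : ((z ^+ m)^*)%R = (z ^+ m)^-1.
  have /eqP norm_z : `|z ^+ m| == 1.
    rewrite -(@pexpr_eq1 _ _ n) // -normrX exprAC (prim_expr_order prim_z).
    by rewrite expr1n normr1.
  by rewrite invC_norm norm_z expr1n invr1 mul1r.
transitivity (\sum_(m < n) \sum_(i < n) \sum_(j < n)
    p`_i * (p`_j)^*%R * ((z ^+ m) ^+ i / (z ^+ m) ^+ j)).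
  apply: eq_bigr => m _; rewrite normCK (horner_coef_wide _ le_pn).
  rewrite rmorph_sum mulr_suml; apply: eq_bigr => i _.
  rewrite mulr_sumr; apply: eq_bigr => j _.
  by rewrite rmorphM rmorphXn /= conj_z exprVn mulrACA.
rewrite exchange_big mulr_sumr; apply: eq_bigr => i _ /=.
rewrite exchange_big (bigD1 i) //= [X in _ + X]big1 ?addr0 => [|j ne_ji].
  by rewrite -mulr_sumr sum_prim_root_ortho // eqxx mulrC normCK.
by rewrite -mulr_sumr sum_prim_root_ortho // eq_sym (negPf ne_ji) mulr0.
Qed.

(** * The arithmetic-geometric bound on the norm *)

Lemma rmorph_horner_int (A B : comNzRingType) (g : {rmorphism A -> B})
    (f : {poly int}) (x : A) :
  g (map_poly intr f).[x] = (map_poly intr f).[g x].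
Proof.
rewrite -horner_map -map_poly_comp; congr (_.[_]).
by apply: eq_map_poly => c; rewrite /= rmorph_int.
Qed.

(** The mean of the |f(w)|^2 over the phi(n) conjugates w of z bounds their
    geometric mean, and is at most 1/phi(n) times their sum over all n-th roots
    of unity, which Parseval's identity evaluates.  Bounding |N|^2 rather than
    |N| keeps all exponents natural. *)
Lemma norm_cyclotomic_norm_le (C : numClosedFieldType)
    (L : splittingFieldType rat) (iota : {rmorphism L -> C})
    (n : nat) (z : L) (f : {poly int}) :
  n.-primitive_root z -> (size f <= n)%N ->
  `|iota (cyclotomic_norm L z (map_poly intr f).[z])| ^+ 2 <=
    (n%:R / (totient n)%:R * \sum_(i < n) (f`_i)%:~R ^+ 2) ^+ totient n.
Proof.
move=> prim_z le_fn; have n_gt0 := prim_order_gt0 prim_z.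
set G := 'Gal(<<1; z>> / 1)%g.
pose F (m : nat) := `|(map_poly intr f).[iota z ^+ m]| ^+ 2 : C.
have prim_w : n.-primitive_root (iota z) by rewrite fmorph_primitive_root.
have expoP (s : gal_of <<1; z>>) : {m : 'I_n | s z = z ^+ m}.
  apply: prim_rootP => //.
  by rewrite -rmorphXn (prim_expr_order prim_z) rmorph1.
pose expo s := sval (expoP s).
(* An element of the Galois group is determined by its value at z, so distinct
   elements give distinct exponents. *)
have expo_inj : {in G &, injective expo}.
  move=> s t Gs Gt eq_st; apply/eqP; rewrite (gal_adjoin_eq Gs Gt).
  by rewrite (svalP (expoP s)) (svalP (expoP t)) -/(expo s) -/(expo t) eq_st.
have normE : `|iota (cyclotomic_norm L z (map_poly intr f).[z])| ^+ 2 =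
    \prod_(s in G) F (expo s).
  rewrite /cyclotomic_norm /galNorm rmorph_prod normr_prod -prodrXl.
  apply: eq_bigr => s _; rewrite /F !rmorph_horner_int -rmorphXn.
  by congr (`|_.[iota _]| ^+ 2); apply: (svalP (expoP s)).
have F_ge0 m : 0 <= F m by rewrite exprn_ge0.
rewrite normE; apply: le_trans (leif_AGM _) _ => [s _|]; first exact: F_ge0.
rewrite /G (card_gal_prim_root _ _ _ prim_z) -/G.
apply: lerXn2r; rewrite ?nnegrE.
- by rewrite divr_ge0 ?ler0n ?sumr_ge0.
- rewrite mulr_ge0 ?divr_ge0 ?ler0n ?sumr_ge0 // => i _.
  by rewrite -rmorphXn ler0z sqr_ge0.
rewrite mulrAC ler_pM2r ?invr_gt0 ?ltr0n ?totient_gt0 //.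
have -> : n%:R * \sum_(i < n) (f`_i)%:~R ^+ 2 = \sum_(m < n) F m :> C.
  rewrite /F Parseval_prim_root //; last exact: leq_trans (size_poly _ _) le_fn.
  congr (_ * _); apply: eq_bigr => i _.
  by rewrite coef_map /= -normrX ger0_norm // -rmorphXn ler0z sqr_ge0.
(* The conjugates contribute a subfamily of the nonnegative terms of the sum
   over all exponents. *)
rewrite -(big_imset (fun m : 'I_n => F m) expo_inj) /=.
by rewrite [leRHS](bigID [in expo @: G]) /= lerDl sumr_ge0.
Qed.

(** * Real inequalities *)

(** From 1 - 1/6 <= e^(-1/6) follows e <= (6/5)^6 = 2.985984; six is the least
    number of steps for which this bound is below 3. *)
Lemma expR1_le3 (R : realType) : expR 1 <= 3 :> R.
Proof.
have le_inv : expR (6^-1) <= 6 / 5 :> R.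
  have := expR_ge1Dx (- 6^-1 : R); rewrite expRN => le6.
  rewrite -lef_pV2 ?posrE ?expR_gt0 // ?divr_gt0 ?ltr0n //.
  apply: le_trans le6; lra.
have -> : 1 = 6^-1 * 6%:R :> R by rewrite mulVf // pnatr_eq0.
rewrite expRM_natr; apply: le_trans (lerXn2r _ _ _ le_inv) _;
  rewrite ?nnegrE ?expR_ge0 //; lra.
Qed.

(** With t = n/m this is the m-th power of t <= e^(t-1), followed by
    e <= 3 <= S. *)
Lemma expn_ratio_le (R : realType) (m n : nat) (S : R) :
  (0 < m <= n)%N -> 3 <= S -> (n%:R / m%:R) ^+ m <= S ^+ (n - m).
Proof.
case/andP=> m_gt0 le_mn S_ge3.
have m_neq0 : m%:R != 0 :> R by rewrite pnatr_eq0 -lt0n.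
apply: (@le_trans _ _ (expR (n%:R / m%:R - 1) ^+ m)).
  apply: lerXn2r; rewrite ?nnegrE ?divr_ge0 ?ler0n ?expR_ge0 //.
  by apply: le_trans (expR_ge1Dx _); rewrite addrC subrK.
rewrite -expRM_natr mulrBl divfK // mul1r -natrB // -[_%:R]mul1r expRM_natr.
apply: lerXn2r; rewrite ?nnegrE ?expR_ge0 //.
  by apply: le_trans S_ge3; rewrite ler0n.
exact: le_trans (expR1_le3 _) S_ge3.
Qed.

Lemma le_powR_half (R : realType) (x y : R) (n : nat) :
  0 <= x -> 0 <= y -> x ^+ 2 <= y ^+ n -> x <= powR y (n%:R / 2).
Proof.
move=> x_ge0 y_ge0 le_xy; rewrite -(@ler_pXn2r _ 2) ?nnegrE ?powR_ge0 //.
rewrite -[leRHS]powR_mulrn ?powR_ge0 // -powRrM divfK ?pnatr_eq0 //.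
by rewrite powR_mulrn.
Qed.

Lemma totient_leq (n : nat) : (totient n <= n)%N.
Proof.
rewrite totient_count_coprime -[leqRHS](card_ord n) -sum1_card big_mkord.
by apply: leq_sum => i _; apply: leq_b1.
Qed.

Theorem theorem3p1 (R : realType) (k : nat) (hk : (0 < k)%N)
    (zeta : R[i]) (hzeta : k.-primitive_root zeta)
    (L : splittingFieldType rat) (iota : {rmorphism L -> R[i]})
    (z : L) (hz : iota z = zeta) (a : nat -> int) :
  let f : {poly int} := \poly_(i < k) a i in
  let N : L := cyclotomic_norm L z (map_poly intr f).[z] in
  let S : R := (\sum_(i < k) a i ^+ 2)%:~R in
  `|iota N|
    <= (powR (k%:R / (totient k)%:R * S) ((totient k)%:R / 2))%:C
  /\ (3 <= S -> `|iota N| <= (powR S (k%:R / 2))%:C).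
Proof.
move=> f N S.
have prim_z : k.-primitive_root z by rewrite -(fmorph_primitive_root iota) hz.
have S_ge0 : 0 <= S by rewrite ler0z sumr_ge0 // => i _; apply: sqr_ge0.
set X := k%:R / (totient k)%:R * S.
have X_ge0 : 0 <= X by rewrite mulr_ge0 ?divr_ge0 ?ler0n.
have [r r_ge0 Dr] : exists2 r : R, 0 <= r & `|iota N| = r%:C.
  by exists (Num.sqrt (complex.Re (iota N) ^+ 2 + complex.Im (iota N) ^+ 2));
     rewrite ?sqrtr_ge0 // normc_def.
have le_r : r ^+ 2 <= X ^+ totient k.
  rewrite -lecR !rmorphXn /= -Dr.
  have := norm_cyclotomic_norm_le _ _ iota _ _ f prim_z (size_poly _ _).
  move/le_trans; apply.
  rewrite le_eqVlt; apply/orP; left; apply/eqP; congr (_ ^+ _).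
  rewrite /X /= !rmorphM /= fmorphV !rmorph_nat; congr (_ * _).
  rewrite rmorph_int rmorph_sum; apply: eq_bigr => i _.
  by rewrite rmorphXn /= coef_poly ltn_ord.
rewrite Dr !lecR; split=> [|S_ge3]; first exact: le_powR_half.
apply: le_powR_half => //; apply: le_trans le_r _.
have le_phi := totient_leq k.
rewrite /X exprMn -[X in _ <= S ^+ X](subnK le_phi) exprD.
rewrite ler_wpM2r ?exprn_ge0 //.
by apply: expn_ratio_le; rewrite // totient_gt0 hk.
Qed.
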